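(* Consider the iterative sampling-and-optimization algorithm described in the context, with the exponential sampling strategy with multiplicative factor $\rho>0$, and let $u(\alpha,\delta,m)$ be the upper bound on the required number of samples defined in the context. Then the number of iterations and the number of optimizer calls are both in $O(\log_{\rho}u(\alpha,\delta,m))$, while the number of samples is in $O(\rho\cdot u(\alpha,\delta,m))$.
   Context: A query has alternative plans and $m$ predicates of unknown selectivity (the selectivity of a predicate is the fraction, between 0 and 1, of input data items satisfying it). An approximation factor $\alpha\ge1$ and a confidence threshold $\delta\in[0,1]$ are given. The cost of every fixed plan is monotone (non-decreasing) in the selectivities. A plan is optimal at a selectivity vector if it has minimal cost there among all plans, and $\alpha$-optimal if its cost there is at most $\alpha$ times the optimal cost. Sampling a predicate means evaluating it on randomly selected data items. In each iteration the algorithm takes the plan that is optimal at the current selectivity sample means, determines a cube (coordinatewise box) around the means in which this plan is $\alpha$-optimal, and computes, via the Hoeffding inequality, the confidence that the true selectivities lie in this cube. It terminates and returns the plan once this confidence is at least $\delta$; otherwise it takes more samples. The number of calls to the standard query optimizer per iteration is bounded by a constant. Exponential sampling strategy with a user-defined constant $\rho>0$: a fixed number of samples is taken in the first iteration; in every later iteration, if $h$ is the total number of samples taken in all prior iterations, $\rho\cdot h$ samples are taken. In every iteration the samples are distributed uniformly over the predicates. Thus the total number of samples grows by the factor $\rho+1$ in each iteration after the first. Assumptions of the analysis: maximal sensitivity assumption (locally around the true selectivities, multiplying the selectivity of each of the $m$ predicates by a factor $f$ may multiply the cost of a plan by up to the factor $f^m$); a plan optimal at $s$ is near-optimal only within its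 minimal cube, bounded by $s\alpha^{-1/(2m)}$ and $s\alpha^{1/(2m)}$, and this cube is reliably discovered in each iteration; all predicates have the same selectivity mean $a$, fixed over the iterations. With $d=a(1-\alpha^{-1/(2m)})$, the upper bound on the number of samples required to find an $\alpha$-optimal plan with confidence $\delta$ is $$u(\alpha,\delta,m)=\frac{m\cdot\log\bigl(2/(1-\sqrt[m]{\delta})\bigr)}{2\cdot d^2},$$ with $\log$ the natural logarithm. *)

(* Defs.v *)
From HB Require Import structures.
From mathcomp Require Import all_boot all_order all_algebra.
From mathcomp Require Import all_classical all_reals all_analysis.

Set Implicit Arguments.
Unset Strict Implicit.
Unset Printing Implicit Defensive.

Import Order.TTheory GRing.Theory Num.Theory.
Import numFieldNormedType.Exports.

Local Open Scope ring_scope.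

Definition selectivities (R : realType) (m : nat) (s : 'rV[R]_m) : Prop :=
  forall i, 0 <= s ord0 i <= 1.

Record query (R : realType) (m : nat) := Query {
  plan : finType;
  cost : plan -> 'rV[R]_m -> R;
  cost_monotone : forall (p : plan) (s t : 'rV[R]_m),
    selectivities s -> selectivities t ->
    (forall i, s ord0 i <= t ord0 i) -> cost p s <= cost p t }.

Section Query.
Variables (R : realType) (m : nat) (q : query R m).

Definition optimal_at (p : plan q) (s : 'rV[R]_m) : Prop :=
  forall p' : plan q, cost p s <= cost p' s.

Definition near_optimal_at (alpha : R) (p : plan q) (s : 'rV[R]_m) : Prop :=
  exists2 p' : plan q, optimal_at p' s & cost p s <= alpha * cost p' s.

(* Both s and its scaling by f lie in a neighbourhood of s0, the vector of true
   selectivities. *)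
Definition maximal_sensitivity (s0 : 'rV[R]_m) : Prop :=
  exists2 e : R, 0 < e &
    forall (p : plan q) (s : 'rV[R]_m) (f : R), 1 <= f ->
      selectivities s -> selectivities (f *: s) ->
      ball s0 e s -> ball s0 e (f *: s) ->
      cost p (f *: s) <= f ^+ m * cost p s.

(* What one iteration observes and decides: the sample means, the plan
   returned by the optimizer, the cube given by its two extreme corners, and
   the number of optimizer calls spent. *)
Record iteration := Iteration {
  means : 'rV[R]_m;
  chosen : plan q;
  lower : 'rV[R]_m;
  upper : 'rV[R]_m;
  calls : nat }.

Definition in_cube (it : iteration) (s : 'rV[R]_m) : Prop :=
  forall i, lower it ord0 i <= s ord0 i <= upper it ord0 i.

Definition valid_iteration (alpha : R) (B : nat) (it : iteration) : Prop :=
  [/\ selectivities (means it),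
      optimal_at (chosen it) (means it),
      in_cube it (means it),
      forall s, selectivities s -> in_cube it s ->
        near_optimal_at alpha (chosen it) s
    & (calls it <= B)%N].

(* With n samples per predicate, the two-sided Hoeffding inequality bounds the
   probability that a mean is off by t or more by 2 exp(-2 n t^2); here t is
   the distance from the mean to the nearer face of the cube. The predicates
   are sampled independently, hence the product. The bound is truncated at 0,
   for otherwise an even number of negative factors would be read as a high
   confidence. *)
Definition confidence (n : R) (it : iteration) : R :=
  \prod_(i < m)
    let t := Num.min (means it ord0 i - lower it ord0 i)
                     (upper it ord0 i - means it ord0 i) in
    Num.max 0 (1 - 2 * expR (- (2 * n * t ^+ 2))).

End Query.

(* Samples taken altogether in the first k iterations. Sample counts are real
   numbers, since rho * h need not be an integer. *)
Fixpoint total_samples (R : realType) (rho : R) (n0 k : nat) : R :=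
  match k with
  | 0 => 0
  | 1 => n0%:R
  | k'.+1 => let h := total_samples rho n0 k' in h + rho * h
  end.

(* A run is given as a sequence indexed by the iterations, numbered from 0;
   only its entries up to the first one that stops are meaningful. *)
Section Run.
Variables (R : realType) (m : nat) (q : query R m).
Variables (delta rho : R) (n0 : nat) (run : nat -> iteration q).

Definition stops (k : nat) : bool :=
  delta <= confidence (total_samples rho n0 k.+1 / m%:R) (run k).

Definition executed (k : nat) : Prop := forall j, (j < k)%N -> ~~ stops j.

Definition terminates_after (K : nat) : Prop :=
  exists k, [/\ K = k.+1, executed k & stops k].

Definition optimizer_calls (K : nat) : nat := (\sum_(k < K) calls (run k))%N.

Definition algorithm_run (alpha : R) (B : nat) : Prop :=
  forall k, executed k -> valid_iteration alpha B (run k).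

(* Worst case of the analysis: near-optimality of a plan optimal at s can be
   relied upon exactly within the minimal cube around s, so this is the cube
   every iteration determines. *)
Definition minimal_cubes (alpha : R) : Prop :=
  forall k, executed k ->
    lower (run k) = alpha `^ (- (2 * m%:R)^-1) *: means (run k) /\
    upper (run k) = alpha `^ ((2 * m%:R)^-1) *: means (run k).

Definition constant_means (a : R) : Prop :=
  forall k, executed k -> means (run k) = const_mx a.

End Run.

(* Meaningful for 1 < alpha, delta < 1 and 0 < a: in the excluded cases the
   bound is infinite, while the total division and ln below return 0. *)
Definition sample_bound (R : realType) (alpha delta : R) (m : nat) (a : R) : R :=
  let d := a * (1 - alpha `^ (- (2 * m%:R)^-1)) in
  m%:R * ln (2 / (1 - delta `^ (m%:R^-1))) / (2 * d ^+ 2).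

Definition logb (R : realType) (b x : R) : R := ln x / ln b.

(* Main.v *)
Require Import Defs.
From HB Require Import structures.
From mathcomp Require Import all_boot all_order all_algebra.
From mathcomp Require Import all_classical all_reals all_analysis.
From mathcomp Require Import ring lra.

Set Implicit Arguments.
Unset Strict Implicit.
Unset Printing Implicit Defensive.

Import Order.TTheory GRing.Theory Num.Theory.
Import numFieldNormedType.Exports.

Local Open Scope ring_scope.

(** With all means equal to a, the distance to the nearer face of every minimal
    cube is d = a (1 - alpha^(-1/(2m))), so the confidence after N samples is
    (1 - 2 exp (- 2 N d^2 / m))^m; this reaches delta exactly when N >= u. The
    totals being n0 (1 + rho)^k, at most 2 + log_(1 + rho) u iterations are
    needed and u is overshot by at most a factor n0 (1 + rho). Changing the base
    from 1 + rho to rho costs a factor that is bounded for rho >= rho0. *)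

Lemma total_samplesE (R : realType) (rho : R) (n0 k : nat) :
  total_samples rho n0 k.+1 = n0%:R * (1 + rho) ^+ k.
Proof.
elim: k => [|k IHk]; first by rewrite expr0 mulr1.
have -> : total_samples rho n0 k.+2 =
  total_samples rho n0 k.+1 + rho * total_samples rho n0 k.+1 by [].
by rewrite IHk exprS; ring.
Qed.

Lemma confidence_ge_sample_bound (R : realType) (m : nat) (q : query R m)
    (alpha delta a N : R) (it : iteration q) :
  (0 < m)%N -> 1 < alpha -> 0 <= delta < 1 -> 0 < a ->
  means it = const_mx a ->
  lower it = alpha `^ (- (2 * m%:R)^-1) *: means it ->
  upper it = alpha `^ ((2 * m%:R)^-1) *: means it ->
  sample_bound alpha delta m a <= N ->
  delta <= confidence (N / m%:R) it.
Proof.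
move=> m_gt0 alpha_gt1 /andP[delta_ge0 delta_lt1] a_gt0 meansE lowerE upperE.
have mR_gt0 : 0 < m%:R :> R by rewrite ltr0n.
rewrite /sample_bound /confidence lowerE upperE meansE powRN.
set x := alpha `^ _.
have x_gt1 : 1 < x.
  have e_gt0 : 0 < (2 * m%:R)^-1 :> R by rewrite invr_gt0 mulr_gt0.
  have := @gt0_ltr_powR _ _ e_gt0 1 alpha; rewrite powR1.
  by apply; rewrite ?nnegrE //; lra.
have x_gt0 : 0 < x by lra.
set d := a * (1 - x^-1); set r := delta `^ m%:R^-1 => le_uN.
have d_gt0 : 0 < d by rewrite mulr_gt0 // subr_gt0 invf_lt1.
have r_ge0 : 0 <= r by exact: powR_ge0.
have rX : r ^+ m = delta.
  by rewrite -powR_mulrn // -powRrM mulVf ?powRr1 ?gt_eqF.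
have r_lt1 : r < 1.
  by rewrite ltNge; apply/negP => /(exprn_ege1 m); rewrite rX leNgt delta_lt1.
(* The upper face is at distance [x * d >= d], so the lower face is the nearer one. *)
have min_d : Num.min (a - x^-1 * a) (x * a - a) = d.
  have -> : a - x^-1 * a = d by rewrite /d; ring.
  have -> : x * a - a = x * d by rewrite /d; field; rewrite gt_eqF.
  by apply/min_idPl; rewrite ler_peMl // ltW.
under eq_bigr do rewrite !mxE min_d.
(* Both sides are [m]-th powers, so it suffices that a single factor reaches [r], the [m]-th root of
   [delta]. *)
rewrite prodr_const card_ord -[leLHS]rX lerXn2r ?nnegrE //.
rewrite le_max; apply/orP; right.
suff : expR (- (2 * (N / m%:R) * d ^+ 2)) <= (1 - r) / 2 by lra.
have y_gt0 : 0 < (1 - r) / 2 by lra.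
(* Taking logarithms leaves [ln (2 / (1 - r)) <= 2 * (N / m) * d ^+ 2], which is [le_uN] with the
   denominators cleared. *)
rewrite -[leRHS]lnK ?posrE // ler_expR lerNl -lnV ?posrE // invf_div.
have d2_gt0 : 0 < 2 * d ^+ 2 by rewrite mulr_gt0 ?exprn_gt0.
move: le_uN; rewrite ler_pdivrMr // mulrC -ler_pdivlMr // => /le_trans; apply.
by rewrite le_eqVlt; apply/orP; left; apply/eqP; ring.
Qed.

(** Passing from the logarithm of [u] to base [1 + rho] to the next larger integer costs at most one
    further factor [1 + rho]. *)
Lemma logn1p_exists (R : realType) (rho u : R) :
  0 < rho -> 1 <= u ->
  exists k : nat, [/\ u <= (1 + rho) ^+ k, (1 + rho) ^+ k <= (1 + rho) * u
    & k%:R <= ln u / ln (1 + rho) + 1].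
Proof.
move=> rho_gt0 u_ge1; set L := ln u / ln (1 + rho).
have l_gt0 : 0 < ln (1 + rho) by rewrite ln_gt0; lra.
have L_ge0 : 0 <= L by rewrite divr_ge0 ?(ltW l_gt0) ?ln_ge0.
have /andP[le_L lt_L] := truncn_itv L_ge0.
have p_gt0 : 0 < 1 + rho by lra.
have u_gt0 : 0 < u by lra.
have lnX n : ln ((1 + rho) ^+ n) = n%:R * ln (1 + rho).
  by rewrite lnXn // mulr_natl.
exists (Num.truncn L).+1; split.
- by rewrite -ler_ln ?posrE ?exprn_gt0 // lnX -ler_pdivrMr // ltW.
- by rewrite exprS ler_pM2l // -ler_ln ?posrE ?exprn_gt0 // lnX -ler_pdivlMr.
- by rewrite -natr1 lerD2r.
Qed.

(** This is the price of changing the base. If [rho >= 1], monotonicity of [ln] suffices; if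
    [rho < 1], then [ln rho] is at most [ln rho0] in absolute value, while [ln (1 + rho)] is at
    least [ln (1 + rho0)]. *)
Lemma norm_ln_le_ln1p (R : realType) (rho0 rho : R) :
  0 < rho0 -> rho0 <= rho ->
  `|ln rho| <= (1 + `|ln rho0| / ln (1 + rho0)) * ln (1 + rho).
Proof.
move=> rho0_gt0 le_rho.
have rho_gt0 : 0 < rho by exact: lt_le_trans le_rho.
have l0_gt0 : 0 < ln (1 + rho0) by rewrite ln_gt0; lra.
have l_ge : ln (1 + rho0) <= ln (1 + rho) by rewrite ler_ln ?posrE; lra.
have l_gt0 : 0 < ln (1 + rho) by exact: lt_le_trans l_ge.
rewrite mulrDl mul1r; have [rho_ge1|rho_lt1] := leP 1 rho.
  rewrite ger0_norm ?ln_ge0 // ler_wpDr //.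
    by rewrite mulr_ge0 ?divr_ge0 // ltW.
  by rewrite ler_ln ?posrE //; lra.
have le_ln : ln rho0 <= ln rho by rewrite ler_ln ?posrE.
have ln_lt0 : ln rho < 0 by rewrite ln_lt0 // rho_gt0.
rewrite (ltr0_norm ln_lt0) ltr0_norm; last exact: le_lt_trans ln_lt0.
rewrite ler_wpDl ?(ltW l_gt0) // mulrAC ler_pdivlMr //.
by apply: ler_pM => //; lra.
Qed.

(** The entries of a run are constrained only while it is still executing, so stopping at [k0] is
    known only conditionally. If nothing stopped up to [k0], then [k0] would be executed and hence
    stop; the least stopping index is the one sought. *)
Lemma first_stop (R : realType) (m : nat) (q : query R m) (delta rho : R)
    (n0 k0 : nat) (run : nat -> iteration q) :
  (executed delta rho n0 run k0 -> stops delta rho n0 run k0) ->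
  exists k, [/\ (k <= k0)%N, executed delta rho n0 run k
    & stops delta rho n0 run k].
Proof.
move=> stop_k0.
have ex_stop : exists k, (k <= k0)%N && stops delta rho n0 run k.
  apply: contrapT => no_stop; apply: (no_stop); exists k0.
  rewrite leqnn stop_k0 // => j lt_j; apply/negP => stop_j.
  by apply: no_stop; exists j; rewrite ltnW.
case: (ex_minnP ex_stop) => k /andP[le_k stop_k] k_min.
exists k; split=> // j lt_j; apply/negP => stop_j.
have : (k <= j)%N by rewrite k_min // stop_j (leq_trans (ltnW lt_j)).
by rewrite leqNgt lt_j.
Qed.

(* The O-constant C is uniform over all rho bounded away from 0, so that the
   factor rho and the base of the logarithm are not absorbed by it. The
   logarithm to base 1 is undefined, whence rho != 1 in the two claims that use
   it; for rho < 1 it is negative, whence the absolute value. *)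
Theorem theorem4 (R : realType) (rho0 : R) (n0 B : nat) :
  0 < rho0 -> (0 < n0)%N ->
  exists2 C : R, 0 < C &
  forall rho : R, rho0 <= rho ->
  exists U : R,
  forall (m : nat) (alpha delta a : R) (q : query R m)
         (truth : 'rV[R]_m) (run : nat -> iteration q),
    (0 < m)%N -> 1 < alpha -> 0 <= delta < 1 -> 0 < a <= 1 ->
    selectivities truth ->
    maximal_sensitivity q truth ->
    algorithm_run delta rho n0 run alpha B ->
    constant_means delta rho n0 run a ->
    minimal_cubes delta rho n0 run alpha ->
    U <= sample_bound alpha delta m a ->
    exists K : nat,
      [/\ terminates_after delta rho n0 run K,
          rho != 1 -> K%:R <= C * `|logb rho (sample_bound alpha delta m a)|,
          rho != 1 -> (optimizer_calls run K)%:R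
                      <= C * `|logb rho (sample_bound alpha delta m a)|
        & total_samples rho n0 K <= C * (rho * sample_bound alpha delta m a)].
Proof.
move=> rho0_gt0 n0_gt0.
set C1 := 1 + `|ln rho0| / ln (1 + rho0).
have l0_gt0 : 0 < ln (1 + rho0) by rewrite ln_gt0; lra.
have C1_ge1 : 1 <= C1 by rewrite lerDl divr_ge0 // ltW.
(* [Cs] uses [1 + rho <= (1 + rho0^-1) * rho]; in [Ci], [C1] pays for the change of base and 2 for
   absorbing an additive constant. *)
set Cs := n0%:R * (1 + rho0^-1); set Ci := 2 * C1.
have Cs_gt0 : 0 < Cs by rewrite mulr_gt0 ?ltr0n ?addr_gt0 ?invr_gt0.
have Ci_gt0 : 0 < Ci by rewrite /Ci; lra.
have B_ge0 : 0 <= B%:R :> R by [].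
exists (Cs + (1 + B%:R) * Ci); first by rewrite addr_gt0 // mulr_gt0 //; lra.
move=> rho le_rho; have rho_gt0 : 0 < rho by exact: lt_le_trans le_rho.
(* This threshold makes the logarithm of [u] to base [1 + rho] at least 2. *)
exists ((1 + rho) ^+ 2) => m alpha delta a q truth run m_gt0 alpha_gt1 delta01.
move=> /andP[a_gt0 _] _ _ valid_run means_a cubes.
set u := sample_bound _ _ _ _ => le_u.
have p_gt1 : 1 < 1 + rho by lra.
have l_gt0 : 0 < ln (1 + rho) by rewrite ln_gt0.
have u_ge1 : 1 <= u by rewrite (le_trans _ le_u) // exprn_ege1 // ltW.
have u_gt0 : 0 < u by lra.
have n0_ge1 : 1 <= n0%:R :> R by rewrite ler1n.
have [k0 [u_le le_pu k0_le]] := logn1p_exists rho_gt0 u_ge1.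
have [|k [le_k exec_k stop_k]] :=
    @first_stop _ _ _ delta rho n0 k0 run => [exec_k0|].
  have [lowerE upperE] := cubes _ exec_k0.
  apply: (confidence_ge_sample_bound m_gt0 alpha_gt1 delta01 a_gt0) => //.
    exact: means_a.
  rewrite total_samplesE (le_trans u_le) // ler_peMl // exprn_ge0 //; lra.
have K_le : rho != 1 -> k.+1%:R <= Ci * `|logb rho u|.
  move=> rho_neq1.
  have lnrho_gt0 : 0 < `|ln rho| by rewrite normr_gt0 ln_eq0.
  have lnu_ge0 : 0 <= ln u by rewrite ln_ge0.
  rewrite /logb normrM normfV (ger0_norm lnu_ge0).
  have two_le : 2 <= ln u / ln (1 + rho).
    rewrite ler_pdivlMr // mulr_natl -lnXn; last lra.
    by rewrite ler_ln ?posrE ?exprn_gt0 //; lra.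
  have k_le : k%:R <= k0%:R :> R by rewrite ler_nat.
  (* With [L] the logarithm to base [1 + rho], [k + 1 <= k0 + 1 <= L + 2 <= 2 * L]. *)
  apply: (@le_trans _ _ (2 * (ln u / ln (1 + rho)))).
    by rewrite -natr1; lra.
  rewrite /Ci -mulrA ler_pM2l // mulrCA ler_wpM2l //.
  rewrite ler_pdivlMr // mulrC ler_pdivrMr //.
  exact: norm_ln_le_ln1p.
have log_ge0 : 0 <= Ci * `|logb rho u| by rewrite mulr_ge0 // ltW.
exists k.+1; split.
- by exists k.
- move=> /K_le /le_trans; apply; rewrite ler_wpM2r // mulrDl mul1r.
  by have := mulr_ge0 B_ge0 (ltW Ci_gt0); lra.
- move=> rho_neq1.
  have calls_le : (optimizer_calls run k.+1 <= k.+1 * B)%N.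
    rewrite -[X in (X * _)%N]card_ord -sum_nat_const; apply: leq_sum => j _.
    (* All iterations up to and including the stopping one [k] are executed, so each spends at most
       [B] calls. *)
    have [|//] := valid_run j _.
    by move=> i lt_ij; apply: exec_k; rewrite (leq_trans lt_ij) // -ltnS.
  apply: (@le_trans _ _ (B%:R * (Ci * `|logb rho u|))).
    apply: (@le_trans _ _ (k.+1 * B)%:R); first by rewrite ler_nat.
    by rewrite natrM mulrC ler_wpM2l // K_le.
  by rewrite mulrA ler_wpM2r //; lra.
- rewrite total_samplesE; apply: (@le_trans _ _ (Cs * (rho * u))).
    rewrite /Cs -mulrA ler_pM2l ?ltr0n //.
    apply: (@le_trans _ _ ((1 + rho) * u)).
      by apply: le_trans le_pu; rewrite ler_weXn2l // ltW.
    rewrite [leRHS]mulrA ler_pM2r // mulrDl mul1r addrC lerD2l.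
    by rewrite mulrC ler_pdivlMr ?mul1r.
  rewrite ler_wpM2r //; first by rewrite mulr_ge0 ?ltW.
  by rewrite lerDl mulr_ge0 ?(ltW Ci_gt0) // addr_ge0.
Qed.
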